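(* Suppose $n=2$ and the cost structure is separable. For any $\theta_0\in[0,1)$, the right-censored outcome and quality functions with threshold $\theta_0$ can be implemented by a score floor auction with quasi-linear score $S(q,p)=q-p$, a score floor and bonus equal to $$\underline S=S^*_{sym}(\theta_0)+\frac{IR(\theta_0,1)}{1-F(\theta_0)},\qquad B=\alpha(1-F(\theta_0))(1-\theta_0),$$ and the equilibrium score strategies $$S^*_i(\theta)=\max\Big\{S^*_{sym}(\theta)+\frac{IR(\theta_0,1)}{1-F(\theta)},\ \underline S\Big\}$$ for both firms.
   Context: Setting. A buyer procures one contract from two firms $i=1,2$ (firm 1 is ''favored''). Types $\theta_i\in[0,1]$ are private, independent with cdf $F$ and strictly positive density $f$. Separable cost structure: the buyer's value of quality is $V(q)=q$; the production (winner-pay) cost is $C^P(q,\theta)=\alpha\theta$ with $\alpha>0$; the investment (all-pay) cost is $C^I(q,\theta)=g(q)$ with $g'>0$, $g''>0$. Standing assumptions for this structure: $J(\theta)=\theta+F(\theta)/f(\theta)$ is strictly increasing; $g(0)=g'(0)=0$ (so $g'(q)>0$ is meant for $q>0$); $g'(q)>1$ at $q=\infty$ (for all large $q$). Each firm, knowing only its own type, chooses a quality $q_i\ge0$ and a price $m_i\in\mathbb R_+$; its profit is $t_i-\alpha\theta_iz_i-g(q_i)$ ($z_i$ share of the contract, $t_i$ transfer to firm $i$). Choosing $(q,m)$ is equivalent to choosing quality $q$ and score $S=q-m$. ''Implemented'' means: the given quality and allocation functions arise in a Bayes–Nash equilibrium of the auction (every type's quality-price choice maximizes interim expected profit over all feasible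 pairs, given the other firm's strategy) with non-negative interim expected profits. Score floor auction with floor $\underline S$ and bonus $B$, where $S_i=q_i-m_i$ and $m_i$ is the price offered: $z_1=\mathbb I(S_1\ge\max\{S_2,\underline S\})$, $t_1=m_1z_1+B\,\mathbb I(S_1\ge\underline S)$, $z_2=\mathbb I(S_2>\max\{S_1,\underline S\})$, $t_2=m_2z_2$. Notation: $q^*_{sym}(\theta)=(g')^{-1}(1-F(\theta))$; $IR(\theta,\theta')=\alpha\int_\theta^{\theta'}(1-F(u))\,du$; $S^*_{sym}(\theta)=q^*_{sym}(\theta)-\alpha\theta-\dfrac{g(q^*_{sym}(\theta))+IR(\theta,1)}{1-F(\theta)}$. Right-censored functions with threshold $\theta_0$: with $\tilde\theta_1=\min(\theta_0,\theta_1)$, the allocation is $z_1(\bm\theta)=\mathbb I(\tilde\theta_1<\theta_2)$, $z_2(\bm\theta)=1-z_1(\bm\theta)$; the qualities are $q_1(\theta_1)=q^*_{sym}(\tilde\theta_1)$, and $q_2(\theta_2)=q^*_{sym}(\theta_2)$ if $\theta_2<\theta_0$, $q_2(\theta_2)=q^*_{sym}(1)$ if $\theta_2>\theta_0$.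
   Formalization: For types above θ0 the score is the floor (the displayed max formula tends to +∞ as θ→1 and fails there); with non-negative prices, excluded firm-2 types that would need a negative price to score the floor ask price 0 instead; the allocation holds almost surely. *)

(* Defs.v *)
(* MathComp / MathComp-Analysis. *)
From HB Require Import structures.
From mathcomp Require Import all_boot all_order all_algebra.
From mathcomp Require Import all_classical all_reals all_analysis.
Set Implicit Arguments.
Unset Strict Implicit.
Unset Printing Implicit Defensive.
Import Order.TTheory GRing.Theory Num.Theory.
Import numFieldNormedType.Exports.
Local Open Scope ring_scope.
Local Open Scope classical_set_scope.

Section Primitives.
Context {R : realType}.
Implicit Types (P : probability (measurableTypeR R) R) (f g : R -> R).

Definition types : set R := `[0, 1].

Definition typeCdf P (x : R) : R := fine (P `]-oo, x]).

(* Both firms' types have law [P]; the pair of types has law [P \x P]. *)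
Definition has_type_density P f : Prop :=
  [/\ measurable_fun types f,
      forall x, 0 <= x <= 1 -> 0 < f x
    & forall A, measurable A ->
        P A = (\int[lebesgue_measure]_(x in A `&` types) (f x)%:E)%E].

Definition virtual_cost P f (x : R) : R := x + typeCdf P x / f x.

(* Only the values of [g] on qualities [0 <= q] matter.  The two-sided
   derivative at [0] costs no generality: a cost given on [0, +oo[ with zero
   right derivative at [0] is extended by [0] to negative arguments. *)
Definition investment_cost g : Prop :=
  [/\ g 0 = 0 /\ g^`() 0 = 0,
      forall q, 0 <= q -> derivable g q 1,
      forall q, 0 < q -> 0 < g^`() q,
      forall q, 0 < q -> derivable g^`() q 1 /\ 0 < g^`(2) q
    & \forall q \near +oo, 1 < g^`() q].

Definition marginal_inv g (y : R) : R := xget 0 [set q | 0 <= q /\ g^`() q = y].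

Definition qsym P g (x : R) : R := marginal_inv g (1 - typeCdf P x).

Definition infoRent (alpha : R) P (x y : R) : R :=
  alpha * \int[lebesgue_measure]_(u in `[x, y]) (1 - typeCdf P u).

(* The division by [1 - F x] is meaningful for [x < 1] only. *)
Definition Ssym (alpha : R) P g (x : R) : R :=
  qsym P g x - alpha * x
  - (g (qsym P g x) + infoRent alpha P x 1) / (1 - typeCdf P x).

End Primitives.

Section Auctions.
Context {R : realType}.
Implicit Types (P : probability (measurableTypeR R) R) (g : R -> R).

(* An offer is a pair (quality, price). *)
Definition offer : Type := (R * R)%type.
Definition score (a : offer) : R := a.1 - a.2.

(* Each rule takes firm 1's offer first. *)
Record auction := Auction {
  share1 : offer -> offer -> R;
  transfer1 : offer -> offer -> R;
  share2 : offer -> offer -> R;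
  transfer2 : offer -> offer -> R }.

Definition wins1 (floor : R) (a1 a2 : offer) : bool :=
  Num.max (score a2) floor <= score a1.
Definition wins2 (floor : R) (a1 a2 : offer) : bool :=
  Num.max (score a1) floor < score a2.

Definition score_floor_auction (floor bonus : R) : auction := {|
  share1 := fun a1 a2 => (wins1 floor a1 a2)%:R;
  transfer1 := fun a1 a2 =>
    a1.2 * (wins1 floor a1 a2)%:R + bonus * (floor <= score a1)%R%:R;
  share2 := fun a1 a2 => (wins2 floor a1 a2)%:R;
  transfer2 := fun a1 a2 => a2.2 * (wins2 floor a1 a2)%:R |}.

Definition profit (alpha : R) g (x q z t : R) : R := t - alpha * x * z - g q.

(* Interim expected profit of a firm with type [x] making offer [a] when the
   other firm follows the strategy [s]. *)
Definition interim1 alpha P g (M : auction) (s : R -> offer) (x : R) (a : offer) : R :=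
  \int[P]_(y in types)
    profit alpha g x a.1 (share1 M a (s y)) (transfer1 M a (s y)).
Definition interim2 alpha P g (M : auction) (s : R -> offer) (x : R) (a : offer) : R :=
  \int[P]_(y in types)
    profit alpha g x a.1 (share2 M (s y) a) (transfer2 M (s y) a).

Definition feasible (prices : set R) : set offer := [set a | 0 <= a.1 /\ prices a.2].

Definition strategy (prices : set R) (s : R -> offer) : Prop :=
  [/\ measurable_fun types (fun x => (s x).1),
      measurable_fun types (fun x => (s x).2)
    & forall x, 0 <= x <= 1 -> feasible prices (s x)].

Definition best_reply (prices : set R) (U : R -> offer -> R) (s : R -> offer) : Prop :=
  forall x, 0 <= x <= 1 -> forall a, feasible prices a -> U x a <= U x (s x).

Definition bayes_nash (prices : set R) alpha P g (M : auction) (s1 s2 : R -> offer) : Prop :=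
  [/\ strategy prices s1, strategy prices s2,
      best_reply prices (interim1 alpha P g M s2) s1
    & best_reply prices (interim2 alpha P g M s1) s2].

(* The strategies [s1], [s2] form an equilibrium with non-negative interim
   profits that generates the qualities [q1], [q2] and, up to ties, the
   allocation [z1], [z2]. *)
Definition implements (prices : set R) alpha P g (M : auction) (s1 s2 : R -> offer)
    (q1 q2 : R -> R) (z1 z2 : R * R -> R) : Prop :=
  [/\ bayes_nash prices alpha P g M s1 s2,
      forall x, 0 <= x <= 1 -> 0 <= interim1 alpha P g M s2 x (s1 x),
      forall x, 0 <= x <= 1 -> 0 <= interim2 alpha P g M s1 x (s2 x),
      forall x, 0 <= x <= 1 -> (s1 x).1 = q1 x /\ (s2 x).1 = q2 x
    & {ae (P \x P)%E, forall t : R * R,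
        share1 M (s1 t.1) (s2 t.2) = z1 t /\ share2 M (s1 t.1) (s2 t.2) = z2 t}].

End Auctions.

Section RightCensored.
Context {R : realType}.
Implicit Types (P : probability (measurableTypeR R) R) (g : R -> R).

Definition z1_cens (x0 : R) (t : R * R) : R := (Num.min x0 t.1 < t.2)%R%:R.
Definition z2_cens (x0 : R) (t : R * R) : R := 1 - z1_cens x0 t.
Definition q1_cens P g (x0 x : R) : R := qsym P g (Num.min x0 x).

(* At the threshold type itself, firm 2 is treated as an excluded type. *)
Definition q2_cens P g (x0 x : R) : R := if x < x0 then qsym P g x else qsym P g 1.

Definition floor_cens (alpha : R) P g (x0 : R) : R :=
  Ssym alpha P g x0 + infoRent alpha P x0 1 / (1 - typeCdf P x0).

Definition bonus_cens (alpha : R) P (x0 : R) : R :=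
  alpha * (1 - typeCdf P x0) * (1 - x0).

Definition score_formula (alpha : R) P g (x0 x : R) : R :=
  Num.max (Ssym alpha P g x + infoRent alpha P x0 1 / (1 - typeCdf P x))
          (floor_cens alpha P g x0).

(* The formula is evaluated at the censored type, so that it equals the floor
   from [x0] on.  It may not be evaluated at [x > x0]: its first term is not
   monotone there and tends to +oo as [x] tends to 1, the numerator
   [infoRent x0 1 - infoRent x 1] staying away from 0 while [1 - F x]
   vanishes. *)
Definition Sstar (alpha : R) P g (x0 x : R) : R :=
  score_formula alpha P g x0 (Num.min x0 x).

End RightCensored.

(* Main.v *)
Require Import Defs.
From HB Require Import structures.
From mathcomp Require Import all_boot all_order all_algebra.
From mathcomp Require Import all_classical all_reals all_analysis.
From mathcomp Require Import measurable_realfun ring lra.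

(* Below the threshold [a], the equilibrium score of type [x] satisfies
   [(q x - S x - alpha x) H x - g (q x) = IR x a] with [H = 1 - F], so that a
   type [x] imitating [y <= a] earns [alpha (y - x) H y + IR y a], up to the
   bonus.  As [H] decreases and [IR y a] integrates [alpha H], this is maximal at
   [y = min a x].  The quality [q y] solves [g' = H y], hence is optimal for a
   firm which wins with probability [H y]; and a score above the floor beats an
   up-set of rival types, so every deviation is dominated by a limit of
   imitations.  An excluded type of firm 1 loses [alpha (x - a) H a] by
   scoring the floor, and the bonus makes the profit of type 1 exactly zero; an
   excluded type of firm 2 stays out.  No derivative of the score is
   needed: it is strictly decreasing since [q h - g (q h) / h] is the maximum over
   [r] of [r - g r / h], which increases with [h]. *)

Set Implicit Arguments.
Unset Strict Implicit.
Unset Printing Implicit Defensive.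
Import Order.TTheory GRing.Theory Num.Theory.
Import numFieldNormedType.Exports.
Local Open Scope ring_scope.
Local Open Scope classical_set_scope.

(** * Investment cost *)

Section InvestmentCost.
Context {R : realType} (g : R -> R).
Hypothesis hg : investment_cost g.

(** The second derivative is available only on positive qualities, so [q = 0] is settled separately
    by [g' 0 = 0 < g' r]. *)
Lemma marginal_lt (q r : R) : 0 <= q -> q < r -> g^`() q < g^`() r.
Proof.
case: hg => -[_ g'0] _ g'pos g'' _; rewrite le_eqVlt => /predU1P[<- r0|q0 qr].
  by rewrite g'0 g'pos.
have dg' x : x \in `[q, r]%R -> derivable g^`() x 1.
  by rewrite in_itv/= => /andP[qx _]; case: (g'' x (lt_le_trans q0 qx)).
apply: (@gtr0_derive1_lt_cc _ g^`() q r); rewrite ?in_itv/= ?lexx ?ltW //.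
- by move=> x xqr; apply: dg'; exact: subset_itv_oo_cc.
- move=> x; rewrite in_itv/= => /andP[qx _].
  by case: (g'' x (lt_trans q0 qx)).
- exact: derivable_within_continuous.
Qed.

Lemma marginal_le (q r : R) : 0 <= q -> q <= r -> g^`() q <= g^`() r.
Proof.
by move=> q0; rewrite le_eqVlt => /predU1P[->//|qr]; exact/ltW/marginal_lt.
Qed.

Lemma marginal_mvt (q r : R) : 0 <= q -> q < r ->
  exists2 c, q < c < r & g r - g q = derive1 g c * (r - q).
Proof.
case: hg => _ dg _ _ _ q0 qr.
have dg' x : x \in `[q, r]%R -> derivable g x 1.
  by rewrite in_itv/= => /andP[qx _]; apply/dg/(le_trans q0).
have [x /subset_itv_oo_cc xqr| |c cqr gE] := @MVT _ g g^`() q r qr.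
- by rewrite derive1E; exact/derivableP/dg'.
- exact: derivable_within_continuous.
- by exists c; rewrite // in_itv/= in cqr.
Qed.

Lemma cost_tangent (q r : R) :
  0 <= q -> 0 <= r -> g q + derive1 g q * (r - q) <= g r.
Proof.
move=> q0 r0; have [qr|rq|->] := ltgtP q r; last by rewrite subrr mulr0 addr0.
- have [c /andP[qc _] gE] := marginal_mvt q0 qr.
  have := marginal_le q0 (ltW qc); nra.
- have [c /andP[rc cq] gE] := marginal_mvt r0 rq.
  have := marginal_le (le_trans r0 (ltW rc)) (ltW cq); nra.
Qed.

Lemma cost_ge0 (q : R) : 0 <= q -> 0 <= g q.
Proof.
move=> q0; have := cost_tangent (lexx 0) q0.
by case: hg => -[-> ->] _ _ _ _; rewrite mul0r addr0.
Qed.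

Lemma cost_gt0 (q : R) : 0 < q -> 0 < g q.
Proof.
move=> q0; have [c /andP[c0 _]] := marginal_mvt (lexx 0) q0.
case: hg => -[-> _] _ g'pos _ _; rewrite !subr0 => ->.
by rewrite mulr_gt0// g'pos.
Qed.

(** Continuity of [g'] at [0] is not assumed. Since [g' 0 = 0], the difference quotient of [g] at
    [0] becomes smaller than [y], and the mean value theorem turns it into a value of [g']. *)
Lemma small_marginal (y : R) : 0 < y -> exists2 c, 0 < c & g^`() c < y.
Proof.
move=> y0; case: (hg) => -[g0 g'0] dg _ _ _.
have dg0 : derivable g 0 1 by apply: dg.
have : \forall h \near 0^', h^-1 *: ((g \o shift 0) (h *: 1) - g 0) < y.
  by apply: (cvgr_lt ('D_1 g 0)); [exact: dg0 | rewrite -derive1E g'0].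
move=> [e /= e0 /(_ (e / 2))] /=.
rewrite sub0r normrN gtr0_norm ?divr_gt0// ltr_pdivrMr// mulr2n mulrDr mulr1.
rewrite ltrDl => /(_ e0); rewrite gt_eqF ?divr_gt0// => /(_ isT).
rewrite /shift /= g0 subr0 addr0 /GRing.scale/= mulr1 => gy.
have [|c /andP[c0 _]] := @marginal_mvt 0 (e / 2) (lexx 0); first exact: divr_gt0.
rewrite g0 !subr0 => gE; exists c => //.
by rewrite -(@mulfK _ (e / 2) _ (g^`() c)) ?gt_eqF ?divr_gt0// -gE mulrC.
Qed.

Lemma marginal_invP (y : R) : 0 <= y <= 1 ->
  0 <= marginal_inv g y /\ g^`() (marginal_inv g y) = y.
Proof.
move=> /andP[y0 y1].
suff [q qP] : exists q, 0 <= q /\ g^`() q = y.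
  by apply: (@xgetPex _ 0 [set q | 0 <= q /\ g^`() q = y]); exists q.
case: (hg) => -[_ g'0] _ _ g'' gInf.
move: y0; rewrite le_eqVlt => /predU1P[<-|y0]; first by exists 0.
have [c c0 cy] := small_marginal y0.
have [M [_ gM]] := gInf.
(* Past [M] the marginal cost exceeds [1 >= y], so [g'] crosses [y] on [[c, Q]], an interval of
   positive qualities, where it is continuous. *)
pose Q := Num.max c (M + 1).
have cQ : c <= Q by rewrite le_max lexx.
have MQ : M < Q by rewrite lt_max ltrDl ltr01 orbT.
have [||q qcQ <-] := @IVT _ g^`() c Q y cQ.
- apply: derivable_within_continuous => x; rewrite in_itv/= => /andP[cx _].
  by case: (g'' x (lt_le_trans c0 cx)).
- rewrite ge_min (ltW cy)/= le_max; apply/orP; right.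
  exact: le_trans y1 (ltW (gM _ MQ)).
- exists q; split=> //; move: qcQ; rewrite in_itv/= => /andP[cq _].
  exact: le_trans (ltW c0) cq.
Qed.

Lemma marginal_inv_ge0 (y : R) : 0 <= y <= 1 -> 0 <= marginal_inv g y.
Proof. by case/marginal_invP. Qed.

Lemma marginal_inv_max (y r : R) : 0 <= y <= 1 -> 0 <= r ->
  y * r - g r <= y * marginal_inv g y - g (marginal_inv g y).
Proof.
move=> /marginal_invP[q0 qy] r0; have := cost_tangent q0 r0; rewrite qy; lra.
Qed.

Lemma marginal_inv0 : marginal_inv g 0 = 0.
Proof.
have [q0 qE] : 0 <= marginal_inv g 0 /\ g^`() (marginal_inv g 0) = 0.
  by apply: marginal_invP; rewrite lexx ler01.
case: hg => _ _ g'pos _ _; apply/eqP; rewrite eq_le q0 andbT leNgt.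
by apply/negP => /g'pos; rewrite qE ltxx.
Qed.

Lemma marginal_inv_gt0 (y : R) : 0 < y <= 1 -> 0 < marginal_inv g y.
Proof.
move=> /andP[y0 y1]; have [] := @marginal_invP y; first by rewrite ltW.
rewrite le_eqVlt => /predU1P[<-|//]; case: hg => -[_ ->] _ _ _ _ yE.
by rewrite -yE ltxx in y0.
Qed.

(** Revealed preference: adding the optimality of each quality against the other leaves
    [(z - y) * (q z - q y) >= 0]. *)
Lemma marginal_inv_le (y z : R) : 0 <= y <= 1 -> 0 <= z <= 1 -> y <= z ->
  marginal_inv g y <= marginal_inv g z.
Proof.
move=> y01 z01; rewrite le_eqVlt => /predU1P[->//|yz].
have := marginal_inv_max y01 (marginal_inv_ge0 z01).
have := marginal_inv_max z01 (marginal_inv_ge0 y01); nra.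
Qed.

End InvestmentCost.

(** * Distribution of types *)

Section TypeDistribution.
Context {R : realType} (P : probability (measurableTypeR R) R).
Local Notation F := (typeCdf P).

Lemma fineK_prob (A : set R) : measurable A -> P A = (fine (P A))%:E.
Proof. by move=> mA; rewrite fineK// fin_num_measure. Qed.

Lemma fine_prob_ge0 (A : set R) : 0 <= fine (P A).
Proof. exact: fine_ge0. Qed.

Lemma fine_prob_le (A B : set R) : measurable A -> measurable B ->
  A `<=` B -> fine (P A) <= fine (P B).
Proof.
by move=> mA mB AB; rewrite fine_le ?fin_num_measure// le_measure ?inE.
Qed.

Lemma typeCdf_ge0 (x : R) : 0 <= F x.
Proof. exact: fine_prob_ge0. Qed.

Lemma typeCdf_le1 (x : R) : F x <= 1.
Proof. by rewrite -lee_fin -fineK_prob// probability_le1. Qed.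

Lemma typeCdf_le (x y : R) : x <= y -> F x <= F y.
Proof.
move=> xy; apply: fine_prob_le => // z /=; rewrite !in_itv/= => zx.
exact: le_trans zx xy.
Qed.

Lemma typeCdf_right_continuous (x e : R) : 0 < e ->
  exists2 d, 0 < d & forall y, x <= y < x + d -> F y - F x < e.
Proof.
move=> e0.
(* [F] is the distribution function of the identity, viewed as a random variable. *)
pose X : measurableTypeR R -> R := idfun.
have mX : measurable_fun setT X by exact: measurable_id.
pose HX := isMeasurableFun.Build _ _ _ _ X mX.
pose X' : {RV P >-> R} := HB.pack X HX.
have cdfE y : cdf X' y = (F y)%:E by rewrite /F -fineK_prob.
have : F y @[y --> x^'+] --> F x.
  have := @cdf_right_continuous _ _ _ P X' x.
  by rewrite cdfE (_ : cdf X' = EFin \o F); [move/fine_cvg|exact/funext].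
move=> /(cvgr_lt (F x)) /(_ (F x + e)); rewrite ltrDl => /(_ e0) [d /= d0 xd].
exists d => // y /andP[]; rewrite le_eqVlt => /predU1P[<- _|xy yd].
  by rewrite subrr.
rewrite ltrBlDl; apply: xd => //=; rewrite ltr_norml; lra.
Qed.

Section Density.
Context (f : R -> R) (hf : has_type_density P f).

Lemma measurable_types : measurable (types : set R).
Proof. exact: measurable_itv. Qed.

Lemma prob_types (A : set R) : measurable A -> P (A `&` types) = P A.
Proof.
have mt := measurable_types; case: hf => _ _ PE mA.
rewrite !PE//; last exact: measurableI.
by rewrite -setIA setIid.
Qed.

Lemma prob_types1 : P types = 1%E.
Proof. by rewrite -(@probability_setT _ _ _ P) -(prob_types measurableT) setTI. Qed.

Lemma prob_set1 (x : R) : P [set x] = 0%E.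
Proof.
case: hf => _ _ ->//; have [xt|xt] := pselect (types x).
  by rewrite setIidl ?integral_set1// => _ ->.
rewrite (_ : _ `&` _ = set0) ?integral_set0//.
by rewrite -subset0 => y [-> /xt].
Qed.

Lemma prob_gt (x : R) : fine (P `]x, +oo[) = 1 - F x.
Proof.
rewrite -setCitvl probability_setC// fineB ?fin_num_measure//.
Qed.

Lemma prob_ge (x : R) : fine (P `[x, +oo[) = 1 - F x.
Proof.
rewrite -prob_gt -(@setU1itv _ _ +oo%O x false)// measureU//.
  by congr fine; rewrite -[RHS]add0e; congr (_ + _)%E; exact: prob_set1.
by rewrite -subset0 => y [->]; rewrite /= in_itv/= ltxx.
Qed.

Lemma typeCdf1 : F 1 = 1.
Proof.
apply/eqP; rewrite eq_le typeCdf_le1/= -[leLHS]/(fine 1%E) -prob_types1.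
apply: fine_prob_le => //; first exact: measurable_types.
by move=> y; rewrite /types/= !in_itv/= => /andP[].
Qed.

Lemma typeCdf_lt (x y : R) : 0 <= x -> x < y -> y <= 1 -> F x < F y.
Proof.
move=> x0 xy y1; rewrite lt_neqAle typeCdf_le ?ltW// andbT; apply/eqP => FE.
have sub : `]x, y] `<=` (types : set R).
  by move=> z; rewrite /types/= !in_itv/= => /andP[xz zy]; apply/andP; split; lra.
have : P `]x, y] = 0%E.
  rewrite fineK_prob//; congr EFin.
  suff : F y = F x + fine (P `]x, y]) by lra.
  rewrite /typeCdf -fineD ?fin_num_measure// -measureU//.
    by rewrite -itv_bndbnd_setU ?bnd_simp// ltW.
  rewrite -subset0 => z [] /=; rewrite !in_itv/= => zx /andP[xz _]; lra.
(* A null interval would make [f] vanish almost everywhere on it; as [f > 0] there, its length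
   [y - x] would be zero. *)
case: hf => mf fpos PE Pxy.
have mfxy : measurable_fun (`]x, y] : set R) (fun z : R => (f z)%:E).
  by apply/measurable_EFinP; apply: measurable_funS mf => //; exact: measurable_types.
have : (\int[@lebesgue_measure R]_(z in `]x, y]) `|(f z)%:E|)%E = 0%E.
  rewrite -Pxy PE// setIidl//; apply: eq_integral => z.
  rewrite inE => /sub; rewrite /types/= in_itv/= => /fpos fz.
  by rewrite ger0_norm ?ltW.
move=> /(ae_eq_integral_abs (@lebesgue_measure R) (measurable_itv _) mfxy) [N [mN N0 sN]].
have : lebesgue_measure `]x, y] = 0%E :> \bar R.
  apply: (subset_measure0 _ mN _ N0) => //.
  move=> z zxy; apply: sN => /= /(_ zxy) [] fz0.
  have := sub _ zxy; rewrite /types/= in_itv/= => /fpos; rewrite fz0 ltxx//.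
rewrite lebesgue_measure_itv/= lte_fin xy -EFinD => -[]; lra.
Qed.

Lemma typeCdf_lt1 (x : R) : 0 <= x < 1 -> F x < 1.
Proof. by move=> /andP[x0 x1]; rewrite -typeCdf1 typeCdf_lt. Qed.

End Density.
End TypeDistribution.

(** * Information rents *)

Section InformationRent.
Context {R : realType} (P : probability (measurableTypeR R) R) (alpha : R).
Local Notation F := (typeCdf P).
Local Notation mu := (@lebesgue_measure R).

Lemma integrable_tail (i : interval R) : (mu [set` i] < +oo)%E ->
  mu.-integrable [set` i] (EFin \o (fun u => 1 - F u)).
Proof.
move=> ioo; apply: measurable_bounded_integrable => //.
- by apply: nonincreasing_measurable => // x y xy; rewrite lerB// typeCdf_le.
- exists 1; split=> // M M1 x _; rewrite /= ger0_norm ?subr_ge0 ?typeCdf_le1//.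
  by rewrite (le_trans _ (ltW M1))// gerBl typeCdf_ge0.
Qed.

Lemma integrable_tail_cc (x y : R) :
  mu.-integrable `[x, y] (EFin \o (fun u => 1 - F u)).
Proof.
apply: integrable_tail; rewrite lebesgue_measure_itv/=.
by case: ifP => // _; rewrite -EFinD ltry.
Qed.

Lemma integrable_tail_oc (x y : R) :
  mu.-integrable `]x, y] (EFin \o (fun u => 1 - F u)).
Proof.
apply: integrable_tail; rewrite lebesgue_measure_itv/=.
by case: ifP => // _; rewrite -EFinD ltry.
Qed.

Lemma infoRentD (x y z : R) : x <= y -> y <= z ->
  infoRent alpha P x z = infoRent alpha P x y + infoRent alpha P y z.
Proof.
move=> xy yz; rewrite /infoRent -mulrDr; congr (alpha * _).
have := @Rintegral_itvB _ (fun u => 1 - F u) (BLeft x) (BRight z) y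
  (integrable_tail_cc x z).
rewrite !bnd_simp => /(_ xy yz).
rewrite [in RHS]Rintegral_itv_obnd_cbnd ?bnd_simp//; last exact: integrable_tail_oc.
by move=> <-; rewrite addrC subrK.
Qed.

Lemma Rintegral_itv_cst (x y c : R) : x <= y ->
  \int[mu]_(u in `[x, y]) c = c * (y - x).
Proof.
move=> xy; rewrite Rintegral_cst//= lebesgue_measure_itv/= lte_fin.
move: xy; rewrite le_eqVlt => /predU1P[->|->]; last by rewrite -EFinD.
by rewrite ltxx subrr.
Qed.

Lemma integrable_cst_cc (x y c : R) : mu.-integrable `[x, y] (EFin \o cst c).
Proof.
apply: measurable_bounded_integrable => //.
- rewrite [X in (X < _)%E]lebesgue_measure_itv/=.
  by case: ifP => // _; rewrite -EFinD ltry.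
- by exists `|c|; split=> [|M cM z _]; [exact: num_real|exact: ltW].
Qed.

Lemma infoRent_ge (x y : R) : 0 <= alpha -> x <= y ->
  alpha * ((1 - F y) * (y - x)) <= infoRent alpha P x y.
Proof.
move=> a0 xy; rewrite /infoRent ler_wpM2l// -Rintegral_itv_cst//.
apply: le_Rintegral => //; [exact: integrable_cst_cc|exact: integrable_tail_cc|].
by move=> u; rewrite /= in_itv/= => /andP[_ uy]; rewrite lerB// typeCdf_le.
Qed.

Lemma infoRent_le (x y : R) : 0 <= alpha -> x <= y ->
  infoRent alpha P x y <= alpha * ((1 - F x) * (y - x)).
Proof.
move=> a0 xy; rewrite /infoRent ler_wpM2l// -Rintegral_itv_cst//.
apply: le_Rintegral => //; [exact: integrable_tail_cc|exact: integrable_cst_cc|].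
by move=> u; rewrite /= in_itv/= => /andP[xu _]; rewrite lerB// typeCdf_le.
Qed.

Lemma infoRent_ge0 (x y : R) : 0 <= alpha -> 0 <= infoRent alpha P x y.
Proof.
move=> a0; rewrite mulr_ge0// Rintegral_ge0// => u _.
by rewrite subr_ge0 typeCdf_le1.
Qed.

Lemma infoRentxx (x : R) : infoRent alpha P x x = 0.
Proof. by have := infoRentD (lexx x) (lexx x); lra. Qed.

End InformationRent.

(** * Censored score and deviations *)

Section EquilibriumScore.
Context {R : realType} (P : probability (measurableTypeR R) R) (f g : R -> R).
Context (alpha a : R).
Hypothesis hf : has_type_density P f.
Hypothesis hg : investment_cost g.
Hypothesis alpha_gt0 : 0 < alpha.
Hypothesis ha : 0 <= a < 1.
Local Notation F := (typeCdf P).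
Local Notation IR := (infoRent alpha P).

(* [q h - g (q h) / h] is the largest net quality per contract won available
   to a firm which wins with probability [h]. *)
Lemma net_quality_lt (h k : R) : 0 < h -> h < k -> k <= 1 ->
  marginal_inv g h - g (marginal_inv g h) / h <
  marginal_inv g k - g (marginal_inv g k) / k.
Proof.
move=> h0 hk k1; have k0 := lt_trans h0 hk.
have h01 : 0 < h <= 1 by rewrite h0 (ltW (lt_le_trans hk k1)).
have k01 : 0 <= k <= 1 by rewrite (ltW k0).
have q0 := marginal_inv_gt0 hg h01; have gq0 := cost_gt0 hg q0.
have le := marginal_inv_max hg k01 (ltW q0).
(* Keep the quality chosen for [h] but win with probability [k]: the cost per contract falls
   strictly, and reoptimizing at [k] can only help. *)
apply: (@lt_le_trans _ _ (marginal_inv g h - g (marginal_inv g h) / k)).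
  by rewrite ltrD2l ltrN2 ltr_pM2l// ltf_pV2.
rewrite -(ler_pM2l k0) !mulrBr.
by rewrite (mulrCA k _ k^-1) (mulrCA k (g (marginal_inv g k))) mulfV ?gt_eqF// !mulr1.
Qed.

(** The score with rents accumulated up to the threshold [a] instead of [1], so that type [a] earns
    nothing beyond the bonus. *)
Definition cens_score (x : R) : R :=
  qsym P g x - alpha * x - (g (qsym P g x) + IR x a) / (1 - F x).

Definition capped_score (x : R) : R := cens_score (Num.min a x).
Local Notation T := capped_score.

Lemma tail_gt0 (x : R) : x <= a -> 0 < 1 - F x.
Proof.
by move=> xa; rewrite subr_gt0 (le_lt_trans (typeCdf_le P xa))// (typeCdf_lt1 hf).
Qed.

Lemma tail_01 (x : R) : 0 <= 1 - F x <= 1.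
Proof. by rewrite subr_ge0 typeCdf_le1 gerBl typeCdf_ge0. Qed.

Lemma qsym_ge0 (x : R) : 0 <= qsym P g x.
Proof. exact/(marginal_inv_ge0 hg)/tail_01. Qed.

Lemma qsym_le (x y : R) : x <= y -> qsym P g y <= qsym P g x.
Proof.
by move=> xy; apply: (marginal_inv_le hg); rewrite ?tail_01// lerB// typeCdf_le.
Qed.

Lemma qsym1 : qsym P g 1 = 0.
Proof. by rewrite /qsym (typeCdf1 hf) subrr (marginal_inv0 hg). Qed.

(** The rent lost between [x] and [y] is at most [alpha * (1 - F x) * (y - x)], which the higher
    production cost offsets; the remaining rent is divided by a smaller winning probability. *)
Lemma cens_rent_le (x y : R) : x <= y -> y <= a ->
  alpha * x + IR x a / (1 - F x) <= alpha * y + IR y a / (1 - F y).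
Proof.
move=> xy ya; have Hx := tail_gt0 (le_trans xy ya); have Hy := tail_gt0 ya.
have Fxy := typeCdf_le P xy.
have := infoRent_le P (ltW alpha_gt0) xy; have := infoRent_ge0 P y a (ltW alpha_gt0).
rewrite (infoRentD P alpha xy ya) => I0 Ixy.
have IV : IR y a / (1 - F x) <= IR y a / (1 - F y).
  by rewrite ler_wpM2l// lef_pV2 ?posrE//; lra.
have : IR x y / (1 - F x) <= alpha * (y - x).
  by rewrite ler_pdivrMr//; lra.
rewrite mulrDl; lra.
Qed.

Lemma cens_score_lt (x y : R) : 0 <= x -> x < y -> y <= a ->
  cens_score y < cens_score x.
Proof.
move=> x0 xy ya; have := cens_rent_le (ltW xy) ya.
have y1 : y <= 1 by rewrite (le_trans ya)// ltW//; case/andP: ha.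
have Fxy := typeCdf_lt hf x0 xy y1.
have := @net_quality_lt (1 - F y) (1 - F x) (tail_gt0 ya).
rewrite -/(qsym P g x) -/(qsym P g y) ltrD2l ltrN2 gerBl typeCdf_ge0 => /(_ Fxy isT).
rewrite /cens_score !mulrDl; lra.
Qed.

(** Negative [x] is allowed, where [F] is flat and strictness fails; monotonicity on the whole line
    is what makes the capped score measurable. *)
Lemma cens_score_le (x y : R) : x <= y -> y <= a -> cens_score y <= cens_score x.
Proof.
move=> xy ya; have := cens_rent_le xy ya.
suff : qsym P g y - g (qsym P g y) / (1 - F y)
     <= qsym P g x - g (qsym P g x) / (1 - F x).
  rewrite /cens_score !mulrDl; lra.
have := typeCdf_le P xy; rewrite le_eqVlt => /predU1P[FE|Fxy].
  by rewrite /qsym FE.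
apply/ltW/net_quality_lt; rewrite ?tail_gt0//; first by rewrite ltrD2l ltrN2.
by rewrite gerBl typeCdf_ge0.
Qed.

Lemma score_formula_cens (x : R) : x <= a ->
  Ssym alpha P g x + IR a 1 / (1 - F x) = cens_score x.
Proof.
case/andP: ha => _ a1 xa; rewrite /Ssym /cens_score (infoRentD P alpha xa (ltW a1)).
by rewrite !mulrDl; ring.
Qed.

Lemma floor_censE : floor_cens alpha P g a = cens_score a.
Proof. exact: score_formula_cens. Qed.

Lemma SstarE (x : R) : Sstar alpha P g a x = T x.
Proof.
have le : Num.min a x <= a by rewrite ge_min lexx.
rewrite /Sstar /score_formula floor_censE score_formula_cens//.
by apply/max_idPl/cens_score_le.
Qed.

Lemma capped_score_le (x y : R) : x <= y -> T y <= T x.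
Proof.
move=> xy; apply: cens_score_le; last by rewrite ge_min lexx.
by rewrite le_min !ge_min lexx xy orbT.
Qed.

(** Strict decrease up to [a] turns comparison of scores into comparison of censored types, hence
    into the right-censored allocation. *)
Lemma capped_score_mono (x y : R) : 0 <= x -> 0 <= y ->
  (T y <= T x) = (Num.min a x <= Num.min a y).
Proof.
case/andP: ha => a0 _ x0 y0; apply/idP/idP => [|xy]; last first.
  by apply: cens_score_le => //; rewrite ge_min lexx.
apply: contraTT; rewrite -!ltNge => yx; apply: cens_score_lt => //.
  by rewrite le_min a0.
by rewrite ge_min lexx.
Qed.

Lemma capped_score_ge (x : R) : cens_score a <= T x.
Proof. by apply: cens_score_le => //; rewrite ge_min lexx. Qed.

Lemma cens_price_ge0 (x : R) : 0 <= x -> x <= a -> 0 <= qsym P g x - cens_score x.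
Proof.
move=> x0 xa; rewrite /cens_score.
have : 0 <= (g (qsym P g x) + IR x a) / (1 - F x).
  apply: divr_ge0; last exact/ltW/tail_gt0.
  by apply: addr_ge0; [exact/(cost_ge0 hg)/qsym_ge0|exact/infoRent_ge0/ltW].
have : 0 <= alpha * x by rewrite mulr_ge0// ltW.
lra.
Qed.

(* Interim profit of type [x], net of the bonus, when it imitates type [y]. *)
Definition mimic (x y : R) : R := alpha * ((y - x) * (1 - F y)) + IR y a.

Lemma mimicE (x y : R) : y <= a ->
  (qsym P g y - cens_score y - alpha * x) * (1 - F y) - g (qsym P g y) = mimic x y.
Proof.
move=> ya; rewrite /mimic /cens_score.
have Hy : 1 - F y != 0 by rewrite gt_eqF// tail_gt0.
by field.
Qed.

Lemma mimic_le (x y : R) : y <= a -> mimic x y <= mimic x (Num.min a x).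
Proof.
move=> ya; rewrite /mimic; have a0 := ltW alpha_gt0.
have ea : Num.min a x <= a by rewrite ge_min lexx.
have xe : Num.min a x <= x by rewrite ge_min lexx orbT.
have [ye|ey] := leP y (Num.min a x).
  have := infoRent_le P a0 ye; rewrite (infoRentD P alpha ye ea).
  have := typeCdf_le P ye; move: (Num.min a x) ea xe ye => e ea xe ye Fye Iye.
  (* This is the surplus of imitating [e] over [y] that remains once [IR y e] is replaced by its
     upper bound [alpha * (1 - F y) * (e - y)]. *)
  have : 0 <= alpha * ((x - e) * (F e - F y)).
    by rewrite !mulr_ge0 ?subr_ge0.
  nra.
have ex : Num.min a x = x.
  by move: ey; rewrite minC /Num.min; case: ifP => // _; lra.
rewrite {}ex in ea xe ey *.
have := infoRent_ge P a0 (ltW ey); rewrite (infoRentD P alpha (ltW ey) ya); lra.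
Qed.

Lemma mimic_self (x : R) : x <= a -> mimic x (Num.min a x) = IR x a.
Proof. by move=> xa; rewrite (min_idPr xa) /mimic subrr mul0r mulr0 add0r. Qed.

Lemma mimic_excluded (x : R) : a <= x ->
  mimic x (Num.min a x) = alpha * ((a - x) * (1 - F a)).
Proof. by move=> ax; rewrite (min_idPl ax) /mimic infoRentxx addr0. Qed.

(** With the score of [y] held fixed, the firm wins with probability [1 - F y], for which
    [qsym P g y] is the best quality. *)
Lemma payoff_le (x y r : R) : y <= a -> 0 <= r ->
  (r - cens_score y - alpha * x) * (1 - F y) - g r <= mimic x y.
Proof.
move=> ya r0; rewrite -mimicE//.
have := marginal_inv_max hg (tail_01 y) r0; rewrite -/(qsym P g y); lra.
Qed.

(** [c] is the infimum of the non-negative types scoring at most [s], a set that contains [a].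
    Whether [c] belongs to it is left open: single types have probability zero. *)
Lemma score_threshold (s : R) : cens_score a <= s ->
  exists c, [/\ 0 <= c <= a, forall y, c < y -> T y <= s
    & forall y, 0 <= y < c -> s < T y].
Proof.
case/andP: ha => a0 _ as_.
pose A : set R := [set y | 0 <= y /\ T y <= s].
have Aa : A a by split; rewrite // /capped_score minxx.
have lA : lbound A 0 by move=> y [].
have hA : has_inf A by split; [exists a|exists 0].
exists (inf A); split.
- by rewrite lb_le_inf//=; [exact: ge_inf hA.2 _ Aa|exists a].
- move=> y /(inf_lt hA.1)[z [_ zs] zy]; exact: le_trans (capped_score_le (ltW zy)) zs.
- move=> y /andP[y0 yA]; rewrite ltNge; apply/negP => ys.
  by have := ge_inf hA.2 (conj y0 ys : A y); rewrite leNgt yA.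
Qed.

(* [s] is compared with the scores of types [y] slightly above the infimum [c] of
   the defeated types: right continuity of [F] is then enough, and continuity of
   the equilibrium score is not needed. *)
Lemma deviation_le (x s c r : R) : 0 <= c <= a -> cens_score a <= s ->
  (forall y, c < y -> T y <= s) -> 0 <= r ->
  (r - s - alpha * x) * (1 - F c) - g r <= mimic x (Num.min a x).
Proof.
move=> /andP[c0 ca] as_ cs r0; apply/ler_addgt0Pr => e e0.
(* [K] bounds the margin at every score from the floor up, so a probability error of [e / K] costs
   at most [e]; the [1] keeps it positive. *)
pose K := `|r - cens_score a - alpha * x| + 1.
have K0 : 0 < K by rewrite ltr_wpDl.
have eK : 0 < e / K by rewrite divr_gt0.
have [y [cy ya ys Fy]] :
    exists y, [/\ c <= y, y <= a, cens_score y <= s & F y - F c <= e / K].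
  (* For [c = a] no type lies between [c] and the threshold, but there [cens_score a <= s] holds
     outright and [y = a] serves. *)
  move: ca; rewrite le_eqVlt => /predU1P[->|ca].
    by exists a; split; rewrite // subrr ltW.
  have [d d0 cd] := typeCdf_right_continuous P c eK.
  exists (Num.min a (c + d / 2)); split.
  - by rewrite le_min (ltW ca) lerDl divr_ge0// ltW.
  - by rewrite ge_min lexx.
  - by apply: (cs (c + d / 2)); rewrite ltrDl divr_gt0.
  - apply/ltW/cd; rewrite le_min (ltW ca) lerDl divr_ge0 ?ltW//=.
    by rewrite gt_min; apply/orP; right; lra.
have Fcy := typeCdf_le P cy.
have yay := cens_score_le ya (lexx a).
have := mimic_le x ya; have := payoff_le x ya r0.
have Hc : 0 <= 1 - F c by case/andP: (tail_01 c).
have : (r - s - alpha * x) * (1 - F c) <= (r - cens_score y - alpha * x) * (1 - F c).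
  by rewrite ler_wpM2r//; lra.
have : (r - cens_score y - alpha * x) * (F y - F c) <= K * (F y - F c).
  rewrite ler_wpM2r ?subr_ge0// /K.
  have := ler_norm (r - cens_score a - alpha * x); lra.
have : K * (F y - F c) <= e by rewrite mulrC -ler_pdivlMr.
lra.
Qed.

(** * Interim profits *)

(** For a fixed offer, profit depends on the rival type only through the event of winning. *)
Lemma Rintegral_affine_indic (k l : R) (b : R -> bool) : measurable [set y | b y] ->
  \int[P]_(y in types) (k + l * (b y)%:R) = k + l * fine (P [set y | b y]).
Proof.
move=> mb; have mt := @measurable_types R; have Pt := prob_types1 hf.
have intP (h : R -> R) (M : R) : measurable_fun (types : set R) h ->
    (forall y, `|h y| <= M) -> P.-integrable types (EFin \o h).
  move=> mh hM; apply: measurable_bounded_integrable => //.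
    by rewrite [ltLHS]Pt ltry.
  exists M; split=> [|N MN y _]; first exact: num_real.
  exact: le_trans (hM y) (ltW MN).
have bE y : (b y)%:R = \1_[set y | b y] y :> R.
  by rewrite indicE; congr (nat_of_bool _)%:R; apply/idP/idP; rewrite inE.
have mI : measurable_fun (types : set R) (\1_[set y | b y] : R -> R).
  exact: measurable_indic.
have I1 y : `|\1_[set y | b y] y : R| <= 1.
  by rewrite -bE; case: (b y) => /=; rewrite ?normr1 ?normr0.
under eq_Rintegral do rewrite bE.
rewrite RintegralD//; last 2 first.
- exact: (intP (cst k) `|k|).
- apply: (intP _ `|l|) => [|y]; first exact: measurable_funM.
  by rewrite normrM ler_piMr.
rewrite Rintegral_cst// [X in fine X]Pt mulr1 RintegralZl//; last exact: intP I1.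
congr (_ + _ * _); rewrite /Rintegral integral_indic//.
by congr fine; exact: (prob_types hf).
Qed.

(** Up to non-types, [A] lies between []c, +oo[] and [[c, +oo[], which have equal probability
    because [P] has no atoms. *)
Lemma prob_up_set (A : set R) (c : R) : measurable A ->
  (forall y, c < y -> A y) -> (forall y, types y -> A y -> c <= y) ->
  fine (P A) = 1 - F c.
Proof.
move=> mA cA Ac; apply/eqP; rewrite eq_le -{1}(prob_ge hf) -(prob_gt P c).
rewrite -{1}(prob_types hf mA) !fine_prob_le//.
- by move=> y; rewrite /= in_itv/= andbT => /cA.
- by apply: measurableI => //; exact: measurable_types.
- by move=> y [Ay ty]; rewrite /= in_itv/= andbT Ac.
Qed.

Lemma measurable_capped_score (D : set R) : measurable D -> measurable_fun D T.
Proof.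
by move=> mD; apply: nonincreasing_measurable => // x y; exact: capped_score_le.
Qed.

Lemma measurable_score_le (s : R) : measurable [set y | T y <= s].
Proof.
have := measurable_capped_score measurableT measurableT (measurable_itv `]-oo, s]%R).
by rewrite setTI; congr measurable; apply/seteqP; split=> y; rewrite /= in_itv.
Qed.

Lemma measurable_score_lt (s : R) : measurable [set y | T y < s].
Proof.
have := measurable_capped_score measurableT measurableT (measurable_itv `]-oo, s[%R).
by rewrite setTI; congr measurable; apply/seteqP; split=> y; rewrite /= in_itv.
Qed.

(** Firm 1 wins ties, so by scoring the floor it beats every rival type above [a]. *)
Lemma win_prob_tie (x : R) : 0 <= x ->
  fine (P [set y | T y <= T x]) = 1 - F (Num.min a x).
Proof.
move=> x0; have a0 : 0 <= a by case/andP: ha.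
have e0 : 0 <= Num.min a x by rewrite le_min a0.
apply: prob_up_set; first exact: measurable_score_le.
- move=> y ey /=; rewrite capped_score_mono ?(le_trans e0 (ltW ey))//.
  by rewrite le_min (ltW ey) andbT ge_min lexx.
- move=> y; rewrite /types/= in_itv/= => /andP[y0 _]; rewrite capped_score_mono//.
  by rewrite le_min => /andP[].
Qed.

(** Firm 2 loses ties, which costs nothing below [a]: there the only tying type is [x] itself. *)
Lemma win_prob_notie (x : R) : 0 <= x -> x < a ->
  fine (P [set y | T y < T x]) = 1 - F x.
Proof.
move=> x0 xa; apply: prob_up_set; first exact: measurable_score_lt.
- move=> y xy /=; rewrite ltNge capped_score_mono ?(le_trans x0 (ltW xy))// -ltNge.
  by rewrite (min_idPr (ltW xa)) lt_min xa.
- move=> y; rewrite /types/= in_itv/= => /andP[y0 _].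
  rewrite ltNge capped_score_mono// -ltNge (min_idPr (ltW xa)) lt_min.
  by case/andP => _ /ltW.
Qed.

Lemma win_prob_floor (s : R) : s <= cens_score a ->
  fine (P [set y | T y < s]) = 0.
Proof.
move=> sa; rewrite (_ : [set y | _] = set0) ?measure0// -subset0 => y /=.
by rewrite ltNge (le_trans sa)// capped_score_ge.
Qed.

Lemma win_prob_le (x s r : R) : cens_score a <= s -> 0 <= r ->
  (r - s - alpha * x) * fine (P [set y | T y <= s]) - g r <= mimic x (Num.min a x).
Proof.
move=> as_ r0; have [c [c0a cs sc]] := score_threshold as_.
rewrite (@prob_up_set _ c); [exact: deviation_le|exact: measurable_score_le|by []|].
move=> y; rewrite /types/= in_itv/= => /andP[y0 _] /= ys; rewrite leNgt.
by apply/negP => yc; have := sc y; rewrite y0 yc ltNge ys => /(_ isT).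
Qed.

(** * Bounds on the profit of any offer *)

Section Play.
Context (B : R).
Local Notation M := (score_floor_auction (cens_score a) B).

(** Only the maximum of the rival score and the floor matters, so the rival's scores below the floor
    may remain unspecified. *)
Lemma interim1E (s2 : R -> offer) (x : R) (o : offer) :
  (forall y, 0 <= y <= 1 -> Num.max (score (s2 y)) (cens_score a) = T y) ->
  interim1 alpha P g M s2 x o =
  B * (cens_score a <= score o)%R%:R - g o.1
  + (o.2 - alpha * x) * fine (P [set y | T y <= score o]).
Proof.
move=> s2T; rewrite -Rintegral_affine_indic; last exact: measurable_score_le.
rewrite /interim1; apply: eq_Rintegral => y.
rewrite inE /types/= in_itv/= /profit/= /wins1 => /s2T ->; ring.
Qed.

Lemma interim2E (s1 : R -> offer) (x : R) (o : offer) :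
  (forall y, 0 <= y <= 1 -> Num.max (score (s1 y)) (cens_score a) = T y) ->
  interim2 alpha P g M s1 x o =
  - g o.1 + (o.2 - alpha * x) * fine (P [set y | T y < score o]).
Proof.
move=> s1T; rewrite -Rintegral_affine_indic; last exact: measurable_score_lt.
rewrite /interim2; apply: eq_Rintegral => y.
rewrite inE /types/= in_itv/= /profit/= /wins2 => /s1T ->; ring.
Qed.

Lemma interim1_le (s2 : R -> offer) (x : R) (o : offer) :
  (forall y, 0 <= y <= 1 -> Num.max (score (s2 y)) (cens_score a) = T y) ->
  0 <= o.1 ->
  interim1 alpha P g M s2 x o <= Num.max 0 (B + mimic x (Num.min a x)).
Proof.
move=> s2T o0; rewrite interim1E// le_max.
have [ao|oa] := leP (cens_score a) (score o).
  apply/orP; right; have := win_prob_le x ao o0.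
  rewrite /score mulr1; lra.
apply/orP; left; rewrite (_ : [set y | _] = set0).
  by rewrite measure0/= !mulr0 addr0 sub0r oppr_le0 (cost_ge0 hg).
rewrite -subset0 => y /= yo.
by have := lt_le_trans oa (capped_score_ge y); rewrite ltNge yo.
Qed.

Lemma interim2_le (s1 : R -> offer) (x : R) (o : offer) :
  (forall y, 0 <= y <= 1 -> Num.max (score (s1 y)) (cens_score a) = T y) ->
  0 <= o.1 ->
  interim2 alpha P g M s1 x o <= Num.max 0 (mimic x (Num.min a x)).
Proof.
move=> s1T o0; rewrite interim2E// le_max; have gr := cost_ge0 hg o0.
have [oa|ao] := leP (score o) (cens_score a).
  by rewrite win_prob_floor// mulr0 addr0 oppr_le0 gr.
(* With a non-positive margin the offer earns at most zero; with a positive one, granting firm 2 the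
   ties only raises its profit and reduces to [win_prob_le]. *)
have [mx|mx] := leP (o.2 - alpha * x) 0.
  apply/orP; left; rewrite addrC subr_le0 (le_trans _ gr)//.
  by rewrite mulr_le0_ge0// fine_prob_ge0.
apply/orP; right; have := win_prob_le x (ltW ao) o0.
rewrite (_ : o.1 - score o = o.2); last by rewrite /score subKr.
rewrite [in X in _ -> X]addrC; apply: le_trans; rewrite lerD2r.
apply: ler_wpM2l; first exact: ltW.
apply: fine_prob_le; [exact: measurable_score_lt|exact: measurable_score_le|].
by move=> y /ltW.
Qed.

End Play.

Lemma bonus_mimic_ge0 (x : R) : x <= 1 ->
  0 <= bonus_cens alpha P a + mimic x (Num.min a x).
Proof.
case/andP: ha => a0 a1 x1; have Ha := ltW (tail_gt0 (lexx a)).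
have a0' := ltW alpha_gt0.
have b0 : 0 <= bonus_cens alpha P a by rewrite /bonus_cens !mulr_ge0// subr_ge0 ltW.
have /orP[xa|ax] := le_total x a.
  by rewrite mimic_self// addr_ge0// infoRent_ge0.
rewrite mimic_excluded// /bonus_cens.
have : 0 <= alpha * (1 - F a) * (1 - x) by rewrite !mulr_ge0// subr_ge0.
lra.
Qed.

(** * Admissibility of the equilibrium offers *)

Lemma q1_cens_ge0 (x : R) : 0 <= q1_cens P g a x.
Proof. exact: qsym_ge0. Qed.

Lemma measurable_q1_cens (D : set R) :
  measurable D -> measurable_fun D (q1_cens P g a).
Proof.
move=> mD; apply: nonincreasing_measurable => // x y xy; apply: qsym_le.
by rewrite le_min !ge_min lexx xy orbT.
Qed.

Lemma measurable_q2_cens (D : set R) :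
  measurable D -> measurable_fun D (q2_cens P g a).
Proof.
case/andP: ha => _ a1 mD; apply: nonincreasing_measurable => // x y xy.
rewrite /q2_cens; case: ifP => ya; first by rewrite (le_lt_trans xy ya) qsym_le.
by case: ifP => // xa; apply/qsym_le/ltW/(lt_trans xa).
Qed.

Lemma q1_price_ge0 (x : R) : 0 <= x -> 0 <= q1_cens P g a x - T x.
Proof.
case/andP: ha => a0 _ x0.
by apply: cens_price_ge0; rewrite ?le_min ?a0// ge_min lexx.
Qed.

Lemma q2_price_ge0 (x : R) : 0 <= x < a -> 0 <= q2_cens P g a x - T x.
Proof.
move=> /andP[x0 xa]; rewrite /q2_cens xa /capped_score (min_idPr (ltW xa)).
exact: cens_price_ge0 (ltW xa).
Qed.

(** For each type of firm 1 the section is a single point, which [P] does not charge. *)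
Lemma negligible_ties :
  (P \x P)%E.-negligible [set t : R * R | t.2 = Num.min a t.1].
Proof.
have mh : measurable_fun setT (fun t : R * R => t.2 - Num.min a t.1).
  apply: measurable_funB; first exact: measurable_snd.
  by apply: measurable_minr => //; exact: measurable_fst.
have mN : measurable [set t : R * R | t.2 = Num.min a t.1].
  have := mh measurableT [set 0] (measurable_set1 0); rewrite setTI.
  congr measurable; apply/seteqP; split=> t /=; last by move=> ->; rewrite subrr.
  by move/eqP; rewrite subr_eq0 => /eqP.
apply/negligibleP => //=; rewrite /product_measure1/= integral0_eq// => x _.
rewrite -[RHS](prob_set1 hf (Num.min a x)); congr (P _).
by apply/seteqP; split=> y; rewrite /xsection/= inE.
Qed.

(** The strategies are controlled on [[0, 1]] only, while [P \x P] is a measure on the whole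
    plane. *)
Lemma negligible_types2 :
  (P \x P)%E.-negligible [set t : R * R | ~ (types t.1 /\ types t.2)].
Proof.
have mt := @measurable_types R; have mtC := measurableC mt.
have PC : P (~` types) = 0%E.
  by rewrite probability_setC// [X in (_ - X)%E](prob_types1 hf) subee.
have N1 : (P \x P)%E.-negligible (~` types `*` setT : set (R * R)).
  apply/negligibleP; first exact: measurableX.
  apply: eq_trans (product_measure1E P P (measurableC mt) measurableT) _.
  by rewrite [X in (X * _)%E]PC mul0e.
have N2 : (P \x P)%E.-negligible (setT `*` ~` types : set (R * R)).
  apply/negligibleP; first exact: measurableX.
  apply: eq_trans (product_measure1E P P measurableT (measurableC mt)) _.
  by rewrite [X in (_ * X)%E]PC mule0.
apply: negligibleS (negligibleU N1 N2) => t /= /not_andP[]; [left|right] => //.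
Qed.

(** Excluded types of firm 2 are only asked to score at most the floor, which leaves their price
    free and covers both price sets at once. *)
Lemma implements_cens (prices : set R) (s2 : R -> offer) :
  (forall x, 0 <= x <= 1 -> prices (q1_cens P g a x - Sstar alpha P g a x)) ->
  strategy prices s2 ->
  (forall x, 0 <= x <= 1 -> (s2 x).1 = q2_cens P g a x) ->
  (forall x, 0 <= x < a -> (s2 x).2 = q2_cens P g a x - Sstar alpha P g a x) ->
  (forall x, a <= x <= 1 -> score (s2 x) <= floor_cens alpha P g a) ->
  implements prices alpha P g
    (score_floor_auction (floor_cens alpha P g a) (bonus_cens alpha P a))
    (fun x => (q1_cens P g a x, q1_cens P g a x - Sstar alpha P g a x)) s2
    (q1_cens P g a) (q2_cens P g a) (z1_cens a) (z2_cens a).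
Proof.
have [a0 a1] := andP ha.
rewrite floor_censE => p1 st2 s2q s2p s2lose.
set s1 := fun x => _.
have s1S x : score (s1 x) = T x by rewrite /score/= SstarE opprB addrC subrK.
have s1T y : Num.max (score (s1 y)) (cens_score a) = T y.
  by rewrite s1S; exact/max_idPl/capped_score_ge.
have s2S y : 0 <= y -> y < a -> score (s2 y) = T y.
  move=> y0 ya; rewrite /score s2q ?s2p ?y0 ?ya//; last by rewrite ltW ?(lt_trans ya).
  by rewrite SstarE opprB addrC subrK.
have s2T y : 0 <= y <= 1 -> Num.max (score (s2 y)) (cens_score a) = T y.
  move=> /andP[y0 y1]; have [ya|ay] := ltP y a.
    by rewrite s2S//; exact/max_idPl/capped_score_ge.
  rewrite (max_idPr _) ?s2lose ?ay//.
  by rewrite /capped_score (min_idPl ay).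
have eq1 x : 0 <= x -> interim1 alpha P g
    (score_floor_auction (cens_score a) (bonus_cens alpha P a)) s2 x (s1 x) =
    bonus_cens alpha P a + mimic x (Num.min a x).
  move=> x0; rewrite interim1E// s1S capped_score_ge win_prob_tie// mulr1.
  by rewrite -mimicE ?ge_min ?lexx//= SstarE /q1_cens /capped_score; ring.
have eq2 x : 0 <= x <= 1 -> interim2 alpha P g
    (score_floor_auction (cens_score a) (bonus_cens alpha P a)) s1 x (s2 x) =
    Num.max 0 (mimic x (Num.min a x)).
  move=> /andP[x0 x1]; rewrite interim2E// s2q ?x0//.
  have /orP[xa|ax] : (x < a) || (a <= x) by rewrite ltNge orNb.
    rewrite s2S// win_prob_notie// s2p ?x0// SstarE (max_idPr _); last first.
      by rewrite mimic_self ?infoRent_ge0 ?ltW.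
    rewrite /q2_cens xa /capped_score (min_idPr (ltW xa)) -mimicE ?ltW//; ring.
  (* An excluded type of firm 2 invests [qsym P g 1 = 0] and never wins, so it earns zero. *)
  rewrite win_prob_floor ?s2lose ?ax// mulr0 addr0 /q2_cens ltNge ax/= qsym1.
  have [[-> _] _ _ _ _] := hg; rewrite oppr0; apply/esym/max_idPl.
  rewrite mimic_excluded//.
  have : 0 <= alpha * ((x - a) * (1 - F a)).
    by rewrite !mulr_ge0 ?subr_ge0// ?typeCdf_le1// ltW.
  lra.
split.
- split=> //.
  + have mt := @measurable_types R; split=> /=.
    * exact: measurable_q1_cens.
    * under eq_fun do rewrite SstarE.
      by apply: measurable_funB; [exact: measurable_q1_cens|exact: measurable_capped_score].
    * by move=> x x01; split=> /=; [exact: q1_cens_ge0|exact: p1].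
  + move=> x /andP[x0 x1] o [q0 _]; rewrite eq1//.
    have := @interim1_le (bonus_cens alpha P a) s2 x o s2T q0.
    by rewrite (max_idPr _)// bonus_mimic_ge0.
  + move=> x x01 o [q0 _]; rewrite eq2//.
    by apply: interim2_le => // y _; exact: s1T.
- by move=> x /andP[x0 x1]; rewrite eq1// bonus_mimic_ge0.
- by move=> x x01; rewrite eq2// le_max lexx.
- by move=> x x01; split=> //; exact: s2q.
apply: negligibleS (negligibleU negligible_ties negligible_types2).
move=> t /= tN; have [|] := pselect (types t.1 /\ types t.2); last by right.
rewrite /types/= !in_itv/= => -[t1 t2]; left; apply: contrapT => /eqP tie; apply: tN.
have [/andP[t10 _] /andP[t20 t21]] := (t1, t2).
(* Score comparison gives the weak inequality; it is strict off the ties. *)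
have w1 : wins1 (cens_score a) (s1 t.1) (s2 t.2) = (Num.min a t.1 < t.2).
  rewrite /wins1 s1S s2T// capped_score_mono// le_min ge_min lexx/=.
  by rewrite [RHS]lt_neqAle eq_sym tie.
have w2 : wins2 (cens_score a) (s1 t.1) (s2 t.2) = ~~ (Num.min a t.1 < t.2).
  rewrite -w1 /wins1 /wins2 s1T s1S s2T//; have [ta|ta] := ltP t.2 a.
    by rewrite s2S// -ltNge.
  (* From [a] on, firm 2 does not exceed the floor, which every type of firm 1 reaches. *)
  rewrite [T t.2]/capped_score (min_idPl ta) capped_score_ge/=; apply/negbTE.
  by rewrite -leNgt (le_trans (s2lose _ _)) ?capped_score_ge ?ta.
by rewrite /= w1 w2 /z2_cens /z1_cens; case: (_ < _); rewrite /= ?subrr ?subr0.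
Qed.

End EquilibriumScore.

(** * Equilibria with unrestricted and with non-negative prices *)

Theorem proposition9 (R : realType) (P : probability (measurableTypeR R) R)
    (f g : R -> R) (alpha theta0 : R)
    (hf : has_type_density P f)
    (hJ : forall x y, 0 <= x -> x < y -> y <= 1 ->
            virtual_cost P f x < virtual_cost P f y)
    (halpha : 0 < alpha)
    (hg : investment_cost g)
    (htheta0 : 0 <= theta0 < 1) :
  let M := score_floor_auction (floor_cens alpha P g theta0)
                               (bonus_cens alpha P theta0) in
  let S := Sstar alpha P g theta0 in
  let q1 := q1_cens P g theta0 in
  let q2 := q2_cens P g theta0 in
  let z1 := z1_cens theta0 in
  let z2 := z2_cens theta0 in
  (* offers (quality, score) with an unrestricted score: firm i scores S *)
  implements setT alpha P g M
    (fun x => (q1 x, q1 x - S x)) (fun x => (q2 x, q2 x - S x)) q1 q2 z1 z2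
  /\
  (* non-negative prices: the same, except that a firm-2 type which could reach
     the score S only with a negative price (it loses anyway) asks price 0 *)
  implements [set m | 0 <= m] alpha P g M
    (fun x => (q1 x, q1 x - S x))
    (fun x => (q2 x, Num.max 0 (q2 x - S x))) q1 q2 z1 z2
  /\
  (* such types are among the excluded ones *)
  (forall x, 0 <= x < theta0 -> 0 <= q2 x - S x).
Proof.
move=> M S q1 q2 z1 z2.
have SE x : S x = capped_score P g alpha theta0 x := SstarE hf hg halpha htheta0 x.
have mt := @measurable_types R.
have mq2 : measurable_fun (types : set R) q2 := measurable_q2_cens P hg htheta0 mt.
have mp2 : measurable_fun (types : set R) (fun x => q2 x - S x).
  apply: measurable_funB => //.
  have -> : S = capped_score P g alpha theta0 by exact/funext.
  exact: (measurable_capped_score hf hg halpha htheta0).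
have q20 x : 0 <= q2 x by rewrite /q2 /q2_cens; case: ifP => _; exact: qsym_ge0.
have p2 x : 0 <= x < theta0 -> 0 <= q2 x - S x.
  by move=> x0; rewrite SE; exact: (q2_price_ge0 hf hg halpha htheta0).
have lose x : theta0 <= x <= 1 -> score (q2 x, q2 x - S x) <= floor_cens alpha P g theta0.
  move=> /andP[tx _]; rewrite /score/= SE (floor_censE _ _ _ htheta0).
  by rewrite /capped_score (min_idPl tx); lra.
split; last split=> //; apply: (implements_cens hf hg halpha htheta0) => //.
- by split=> // x _; split=> //=; exact: q20.
- move=> x /andP[x0 _] /=; rewrite -/(S x) SE.
  exact: (q1_price_ge0 hf hg halpha htheta0).
- split=> //=; first exact: measurable_maxr.
  by move=> x _; split=> //=; rewrite le_max lexx.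
- by move=> x /p2 px; exact/max_idPr.
(* Raising a negative price to [0] lowers the score, so the type still loses. *)
- move=> x /lose; apply: le_trans; rewrite /score/=.
  by rewrite lerB// le_max lexx orbT.
Qed.
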